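(* Fix a motif specification on $p,L$ and let $H$ be its hypergraph. Then for every $N>0$ there exists a finite set $\mathcal S\subseteq\mathbb{R}^p$ whose size $r$ satisfies $r\ge N$ and $\mathcal M(\mathcal S)\ge (r/L)^{\nu^*(H)}$.
   Context: Let $L,p$ be positive integers. A motif specification on $p,L$ consists of partitions $\pi_1,\dots,\pi_p$, where each $\pi_m$ is a partition of some subset of $\{1,\dots,L\}$, together with real constants $D_{im}$ for each pair $(i,m)$ with $i$ in no block of $\pi_m$. A tuple $(f_1,\dots,f_L)\in(\mathbb{R}^p)^L$ is a motif if (1) whenever $i,j$ lie in the same block of $\pi_m$, $(f_i)_m=(f_j)_m$; and (2) whenever $i$ lies in no block of $\pi_m$, $(f_i)_m=D_{im}$. For $\mathcal S\subseteq\mathbb{R}^p$, $\mathcal M(\mathcal S)$ is the number of $L$-tuples of elements of $\mathcal S$ (repetitions allowed) that are motifs. The hypergraph $H$ has vertex set $\{1,\dots,L\}$ and one edge for each block of each $\pi_m$, consisting of the elements of that block. A fractional matching of $H$ is $f:E(H)\to\mathbb{R}_{\ge0}$ with $\sum_{e\ni x}f(e)\le1$ for every vertex $x$; $\nu^*(H)$ is the maximum of $\sum_e f(e)$ over fractional matchings. Convention: $0^0=1$. *)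

(* Defs.v *)
From HB Require Import structures.
From mathcomp Require Import all_boot all_order all_algebra finmap.
From mathcomp Require Import all_classical all_reals all_analysis.

Set Implicit Arguments.
Unset Strict Implicit.
Unset Printing Implicit Defensive.

Import Order.TTheory GRing.Theory Num.Theory numFieldNormedType.Exports.

Local Open Scope classical_set_scope.
Local Open Scope ring_scope.

(* Edges are indexed by a finite type, so parallel edges are allowed. *)
Record hypergraph (V : finType) := Hypergraph {
  edge : finType;
  incidence : edge -> {set V}
}.

Section FractionalMatching.
Variables (R : realType) (V : finType) (H : hypergraph V).

Definition fractional_matching (f : edge H -> R) : Prop :=
  (forall e, 0 <= f e) /\
  (forall x : V, \sum_(e | x \in incidence e) f e <= 1).

Definition matching_weight (f : edge H -> R) : R := \sum_e f e.

(* When no edge is empty this supremum is a maximum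
   (fractional_matching_number_max below); otherwise the set is unbounded and
   the value is the default 0 of sup. *)
Definition fractional_matching_number : R :=
  sup [set matching_weight f | f in fractional_matching].

Lemma fractional_matching_number_max :
  (forall e : edge H, incidence e != finset.set0) ->
  exists f, [/\ fractional_matching f,
    matching_weight f = fractional_matching_number &
    forall g, fractional_matching g -> matching_weight g <= matching_weight f].
Proof.
move=> H0; pose n := #|edge H|.
pose F (v : 'rV[R]_n) (e : edge H) : R := v ord0 (enum_rank e).
pose A : set 'rV[R]_n := [set v | fractional_matching (F v)].
pose row_of (f : edge H -> R) : 'rV[R]_n := \row_j f (enum_val j).
have rowK f : F (row_of f) = f.
  by apply/funext => e; rewrite /F mxE enum_rankK.
have Fcont e : continuous (F^~ e) by exact: coord_continuous.
have sumcont (P : pred (edge H)) : continuous (fun v => \sum_(e | P e) F v e).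
  by apply: continuous_big => [|e _]; [exact: add_continuous|exact: Fcont].
have zeroA : A (row_of (fun=> 0)).
  rewrite /A /= rowK; split => // x.
  by rewrite big1.
have Acl : closed A.
  have -> : A = (\bigcap_(e in [set: edge H]) (F^~ e) @^-1` [set y | 0 <= y]) `&`
    (\bigcap_(x in [set: V])
      (fun v => \sum_(e | x \in incidence e) F v e) @^-1` [set y | y <= 1]).
    apply/seteqP; split => [v [v0 v1]|v [v0 v1]].
      by split => x _; [exact: v0|exact: v1].
    by split => x; [exact: (v0 x I)|exact: (v1 x I)].
  apply: closedI; apply: closed_bigI => x _.
    by apply: preimage_closed => [v _|]; [exact: Fcont|exact: closed_ge].
  by apply: preimage_closed => [v _|]; [exact: sumcont|exact: closed_le].
have Aco : compact A.
  apply: (subclosed_compact Acl).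
    exact: (rV_compact (fun=> @segment_compact R 0 1)).
  move=> v [v0 v1] i /=; rewrite in_itv /=.
  have vi : v ord0 i = F v (enum_val i) by rewrite /F enum_valK.
  rewrite vi v0 /=; have /set0Pn[x xe] := H0 (enum_val i).
  apply: le_trans (v1 x); rewrite (bigD1 (enum_val i)) //= lerDl.
  by apply: sumr_ge0 => e _; exact: v0.
have /(_ (ex_intro _ _ zeroA) Aco) := @EVT_max_rV R n (fun v => \sum_e F v e) A.
case=> [|c /set_mem cA cmax]; first exact/continuous_subspaceT/sumcont.
have gmax g : fractional_matching g ->
    matching_weight g <= matching_weight (F c).
  move=> Hg; have := cmax (row_of g); rewrite rowK; apply.
  by apply/mem_set; rewrite /A /= rowK.
exists (F c); split => //; apply/eqP; rewrite eq_le; apply/andP; split.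
  apply: ub_le_sup; last by exists (F c).
  by exists (matching_weight (F c)) => _ [g Hg <-]; exact: gmax.
apply: ge_sup; first by exists (matching_weight (F c)); exists (F c).
by move=> _ [g Hg <-]; exact: gmax.
Qed.

End FractionalMatching.

(* Only the values constant i m with i outside finset.cover (blocks m) are used. *)
Record motif_spec (R : realType) (p L : nat) := MotifSpec {
  blocks : 'I_p -> {set {set 'I_L}};
  blocks_partition : forall m, finset.partition (blocks m) (finset.cover (blocks m));
  constant : 'I_L -> 'I_p -> R
}.

Definition motif_hypergraph (R : realType) (p L : nat)
    (M : motif_spec R p L) : hypergraph 'I_L :=
  @Hypergraph 'I_L {mB : 'I_p * {set 'I_L} | mB.2 \in blocks M mB.1}
    (fun e => (val e).2).

Lemma motif_hypergraph_edge_neq0 (R : realType) (p L : nat)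
    (M : motif_spec R p L) (e : edge (motif_hypergraph M)) :
  incidence e != finset.set0.
Proof.
case: e => [[m B] /= Bm]; have /and3P[_ _ B0] := blocks_partition M m.
by apply: contraNneq B0 => <-.
Qed.

Definition is_motif (R : realType) (p L : nat) (M : motif_spec R p L)
    (f : 'I_L -> 'rV[R]_p) : Prop :=
  (forall (m : 'I_p) (B : {set 'I_L}), B \in blocks M m ->
     forall i j : 'I_L, i \in B -> j \in B -> f i ord0 m = f j ord0 m) /\
  (forall (m : 'I_p) (i : 'I_L),
     (forall B : {set 'I_L}, B \in blocks M m -> i \notin B) ->
     f i ord0 m = constant M i m).

Definition motif_count (R : realType) (p L : nat) (M : motif_spec R p L)
    (S : {fset 'rV[R]_p}) : nat :=
  #|[set t : {ffun 'I_L -> S} | `[< is_motif M (fun i => val (t i)) >]]%SET|.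

(* Main.v *)
(** Let [f] be a maximum fractional matching. A rational point that satisfies
    all rational linear equations valid for [f] and is close enough to [f] is
    still a fractional matching, and so is its reflection through [f]; hence
    it is also maximum. So some maximum matching has the form [a e / D] with
    integers [a e]. Give each edge [q ^ a e] colours: a colouring of the edges
    determines a motif, and at most [q ^ D] different points occur at a given
    position, because the weights at a vertex sum to at most [D]. Padding the
    set of these points to exactly [L * q ^ D] elements leaves at least
    [q ^ (\sum_e a e)] motifs, which is [(q ^ D) `^ nu]. *)

Require Import Defs.
From HB Require Import structures.
From mathcomp Require Import all_boot all_order all_algebra finmap.
From mathcomp Require Import ring lra.
From mathcomp Require Import all_classical all_reals all_analysis.
Import Order.TTheory GRing.Theory Num.Theory numFieldNormedType.Exports.

Local Open Scope ring_scope.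

(** * Rational approximation that keeps linear relations *)

Lemma rat_approximation (R : realType) (x e : R) : 0 < e ->
  exists q : rat, `|x - ratr q| < e.
Proof.
move=> e0; have [|q] := @rat_in_itvoo R (x - e) (x + e); first by lra.
rewrite in_itv /= => /andP[h1 h2]; exists q.
by rewrite ltr_norml; apply/andP; split; lra.
Qed.

(* A real that is rationally dependent on the others has to receive the same
   rational combination of their approximations; an independent one is free. *)
Lemma rat_approximation_relations (R : realType) (I : eqType) (v : I -> R)
    (s : seq I) (e : R) : uniq s -> 0 < e ->
  exists q : I -> rat,
    (forall i, i \in s -> `|v i - ratr (q i)| < e) /\
    (forall a : I -> rat,
      \sum_(i <- s) ratr (a i) * v i = 0 -> \sum_(i <- s) a i * q i = 0).
Proof.
elim: s e => [|x s IH] e /=.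
  by move=> _ _; exists (fun=> 0); split => // a _; rewrite big_nil.
move=> /andP[xs us] e0.
pose upd (q : I -> rat) y i := if i == x then y else q i.
have sum_upd (a q : I -> rat) y :
    \sum_(i <- x :: s) a i * upd q y i = a x * y + \sum_(i <- s) a i * q i.
  rewrite big_cons {1}/upd eqxx; congr (_ + _); apply: eq_big_seq => i si.
  by rewrite /upd; case: eqP => // ix; rewrite -ix si in xs.
have near_upd (q : I -> rat) y : `|v x - ratr y| < e ->
    (forall i, i \in s -> `|v i - ratr (q i)| < e) ->
    forall i, i \in x :: s -> `|v i - ratr (upd q y i)| < e.
  by move=> hy hq i; rewrite inE /upd; case: eqP => [->|_] //= /hq.
have [[c vx]|indep] :=
    pselect (exists c : I -> rat, v x = \sum_(i <- s) ratr (c i) * v i).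
  (* An error below [e / k] on [s] becomes one below [e] on [v x]; the summand 1 makes this strict
     and gives [e / k <= e]. *)
  pose k : R := 1 + \sum_(i <- s) `|ratr (c i)|.
  have k1 : 1 <= k by rewrite lerDl; apply: sumr_ge0.
  have k0 : 0 < k by apply: lt_le_trans k1.
  have ek0 : 0 < e / k by apply: divr_gt0.
  have [q [q_near q_rel]] := IH _ us ek0.
  exists (upd q (\sum_(i <- s) c i * q i)); split.
    apply: near_upd => [|i si]; last first.
      by apply: lt_le_trans (q_near i si) _; rewrite ler_pdivrMr // ler_peMr // ltW.
    rewrite vx rmorph_sum /= -sumrB.
    apply: (@le_lt_trans _ _ (\sum_(i <- s) `|ratr (c i)| * (e / k))).
      apply: le_trans (ler_norm_sum _ _ _) _.
      rewrite big_seq [leRHS]big_seq; apply: ler_sum => i si.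
      by rewrite rmorphM /= -mulrBr normrM ler_wpM2l // ltW // q_near.
    rewrite -mulr_suml mulrA ltr_pdivrMr // mulrC ltr_pM2l //.
    by rewrite /k ltrDr.
  move=> a; rewrite big_cons sum_upd vx mulr_sumr -big_split /= => rel.
  rewrite mulr_sumr -big_split /=.
  rewrite -[RHS](q_rel (fun i => a x * c i + a i)); last first.
    by rewrite -[RHS]rel; apply: eq_bigr => i _; rewrite rmorphD rmorphM /=; ring.
  by apply: eq_bigr => i _; ring.
have [q [q_near q_rel]] := IH _ us e0.
have [y ynear] := rat_approximation R (v x) e e0.
exists (upd q y); split; first exact: near_upd.
move=> a; rewrite big_cons sum_upd => rel.
(* A relation with nonzero coefficient at [x] could be solved for [v x]. *)
have ax0 : a x = 0.
  apply/eqP/negPn/negP => ax; apply: indep; exists (fun i => - (a i / a x)).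
  have rax : ratr (a x) != 0 :> R by rewrite fmorph_eq0.
  apply: (mulfI rax); rewrite mulr_sumr.
  move/eqP: rel; rewrite addr_eq0 => /eqP ->; rewrite -sumrN.
  by apply: eq_bigr => i _; rewrite rmorphN fmorph_div /=; field.
rewrite ax0 mul0r add0r; apply: q_rel.
by move: rel; rewrite ax0 rmorph0 mul0r add0r.
Qed.

(** * Integral form of an optimal matching *)

Lemma common_denominator (I : finType) (q : I -> rat) :
  exists (D : nat) (z : I -> int), (0 < D)%N /\
    forall i, q i * D%:R = (z i)%:~R.
Proof.
exists (\prod_i `|denq (q i)|)%N.
exists (fun i => numq (q i) * (\prod_(j | j != i) `|denq (q j)|)%:R); split.
  by rewrite prodn_gt0 // => i; rewrite absz_gt0 denq_neq0.
move=> i; rewrite (bigD1 i) //= natrM mulrA intrM.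
by rewrite natr_absz normr_denq -numqE rmorph_nat.
Qed.

Lemma positive_lower_bound (R : realType) (J : finType) (u : J -> R) :
  exists d : R, [/\ 0 < d, d <= 1 & forall j, 0 < u j -> d <= u j].
Proof.
exists (\big[Num.min/1]_(j | 0 < u j) u j); split => [||j uj].
- exact: lt_bigmin.
- exact: bigmin_le_id.
- exact: bigmin_le_cond.
Qed.

Lemma integral_optimal_matching (R : realType) (V : finType)
    (H : hypergraph V) : (forall e : edge H, incidence e != finset.set0) ->
  exists (D : nat) (a : edge H -> nat),
    [/\ (0 < D)%N, (forall x, \sum_(e | x \in incidence e) a e <= D)%N &
      fractional_matching_number R H * D%:R <= \sum_e (a e)%:R].
Proof.
move=> H0; have [f [[f0 f1] fnu fmax]] := fractional_matching_number_max R H0.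
set nu := fractional_matching_number R H in fnu *.
(* The coordinate [None] holds the vertex capacity, which is 1 for [f]. The constraints thus become
   homogeneous, like the relations that the approximation keeps. *)
pose feasible (w : option (edge H) -> R) :=
  (forall e, 0 <= w (Some e)) /\
  (forall x, \sum_(e | x \in incidence e) w (Some e) <= w None).
have feasible_bound w : 0 < w None -> feasible w ->
    \sum_e w (Some e) <= nu * w None.
  move=> w0 [wge0 wle]; rewrite -ler_pdivrMr // mulr_suml.
  rewrite -fnu; apply: (fmax (fun e => w (Some e) / w None)); split => [e|x].
    by rewrite divr_ge0 // ltW.
  by rewrite -mulr_suml ler_pdivrMr // mul1r.
pose v (i : option (edge H)) : R := oapp f 1 i.
pose slack x := 1 - \sum_(e | x \in incidence e) f e.
have [d1 [d1_gt0 d1_le1 d1f]] := positive_lower_bound R _ f.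
have [d2 [d2_gt0 d2_le1 d2s]] := positive_lower_bound R _ slack.
(* A vertex constraint involves at most [n] coordinates, capacity included, so moving each by less
   than [d / n] cannot use up a slack of at least [d]. *)
pose d := Num.min d1 d2; pose n : R := #|edge H|%:R + 1.
have d_gt0 : 0 < d by rewrite lt_min d1_gt0.
have d_d1 : d <= d1 by rewrite ge_min lexx.
have d_d2 : d <= d2 by rewrite ge_min lexx orbT.
have n1 : 1 <= n by rewrite lerDr.
have n0 : 0 < n by apply: lt_le_trans n1.
pose eps := d / n.
have eps_gt0 : 0 < eps by rewrite divr_gt0.
have eps_d : eps <= d by rewrite ler_pdivrMr // ler_peMr // ltW.
(* Constraints strict at [f] survive a small move; those tight at [f] must be kept as equalities. *)
have near_feasible w : (forall i, `|v i - w i| < eps) ->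
    (forall e, f e = 0 -> w (Some e) = 0) ->
    (forall x, slack x = 0 ->
      \sum_(e | x \in incidence e) w (Some e) = w None) -> feasible w.
  move=> wv wf ws; split => [e|x].
    have := f0 e; rewrite le_eqVlt => /orP[/eqP/esym/wf ->//|fe].
    have := d1f _ fe; have := wv (Some e); rewrite ltr_norml /= => /andP[_].
    by lra.
  have : 0 <= slack x by rewrite subr_ge0.
  rewrite le_eqVlt => /orP[/eqP/esym/ws ->//|sx].
  have := d2s _ sx; have := wv None; rewrite ltr_norml /= => /andP[_ wN].
  have : \sum_(e | x \in incidence e) (w (Some e) - f e) <= #|edge H|%:R * eps.
    apply: (@le_trans _ _ (\sum_(e | x \in incidence e) eps)).
      apply: ler_sum => e _; have := wv (Some e).
      by rewrite distrC ltr_norml /= => /andP[_ /ltW].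
    by rewrite sumr_const [leRHS]mulr_natl ler_wpMn2l ?max_card // ltW.
  rewrite sumrB.
  have : #|edge H|%:R * eps + eps = d.
    by rewrite -[X in _ + X]mul1r -mulrDl mulrC divfK // gt_eqF.
  rewrite /slack.
  by lra.
have [q [qv qrel]] := rat_approximation_relations R _ v _ eps
  (index_enum_uniq (option (edge H))) eps_gt0.
have {}qv i : `|v i - ratr (q i)| < eps by exact/qv/mem_index_enum.
have sum_option (U : nmodType) (F : option (edge H) -> U) :
    \sum_i F i = F None + \sum_e F (Some e).
  rewrite (bigD1 None) //=; congr (_ + _).
  rewrite (reindex_omap Some id) /=; last by case.
  by apply: eq_bigl => e; rewrite eqxx.
have q_zero e : f e = 0 -> q (Some e) = 0.
  have delta (U : pzRingType) (F : option (edge H) -> U) :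
      \sum_i (i == Some e)%:R * F i = F (Some e).
    rewrite (bigD1 (Some e)) //= eqxx mul1r big1 ?addr0 // => i /negPf ->.
    by rewrite mul0r.
  move=> fe; have /qrel : \sum_i ratr (i == Some e)%:R * v i = 0.
    by under eq_bigr do rewrite ratr_nat; rewrite delta.
  by rewrite delta.
have q_tight x : slack x = 0 ->
    \sum_(e | x \in incidence e) q (Some e) = q None.
  move=> sx.
  have := qrel (fun i => if i is Some e then (x \in incidence e)%:R else -1).
  rewrite !sum_option /= rmorphN rmorph1 !mulN1r.
  have -> : \sum_e ratr (x \in incidence e)%:R * f e =
      \sum_(e | x \in incidence e) f e.
    by rewrite [RHS]big_mkcond; apply: eq_bigr => e _;
      case: ifP; rewrite ?rmorph1 ?rmorph0 ?mul1r ?mul0r.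
  have -> : \sum_e (x \in incidence e)%:R * q (Some e) =
      \sum_(e | x \in incidence e) q (Some e).
    by rewrite [RHS]big_mkcond; apply: eq_bigr => e _;
      case: ifP; rewrite ?mul1r ?mul0r.
  move: sx; rewrite /slack => sx h; apply/eqP; rewrite -subr_eq0 addrC; apply/eqP.
  by apply: h; lra.
pose w i : R := ratr (q i).
have w_tight x : slack x = 0 ->
    \sum_(e | x \in incidence e) w (Some e) = w None.
  by move=> /q_tight; rewrite /w => <-; rewrite rmorph_sum.
have w_feasible : feasible w.
  by apply: near_feasible => // e /q_zero; rewrite /w => ->; rewrite rmorph0.
(* The reflection of [w] through the maximizer [v] is feasible too, so neither
   of the two can be worse than optimal. *)
have w'_feasible : feasible (fun i => 2 * v i - w i).
  apply: near_feasible => [i|e fe|x sx].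
  - by rewrite -normrN opprB (_ : _ - v i = v i - w i) //; ring.
  - by rewrite /= fe /w q_zero // rmorph0; lra.
  - by rewrite sumrB -mulr_sumr w_tight //=; move: sx; rewrite /slack /=; lra.
have wNone : 0 < w None /\ 0 < 2 * v None - w None.
  have := qv None; rewrite ltr_norml /= -/(w None) => /andP[h1 h2].
  by split; lra.
have wN_ge0 : 0 <= w None by exact: ltW wNone.1.
have w_opt : nu * w None <= \sum_e w (Some e).
  have := feasible_bound _ wNone.2 w'_feasible; rewrite sumrB -mulr_sumr /=.
  move: fnu; rewrite /matching_weight => ->.
  by lra.
have [d0 [z [d0_gt0 zq]]] := common_denominator _ q.
have wz i : 0 <= w i -> (`|z i|%N)%:R = w i * d0%:R.
  move=> wi; have zw : (z i)%:~R = w i * d0%:R.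
    have /(congr1 (ratr : rat -> R)) := zq i.
    by rewrite rmorphM /= ratr_nat ratr_int.
  rewrite -zw natr_absz ger0_norm // -(ler0z R) zw mulr_ge0 //.
(* Clearing denominators scales the capacity too, so [D] is the scaled capacity [w None * d0] and
   not [d0]. *)
exists `|z None|%N, (fun e => `|z (Some e)|%N); split.
- rewrite -(ltr0n R) wz // mulr_gt0 ?wNone.1 //.
  by rewrite ltr0n.
- move=> x; rewrite -(ler_nat R) natr_sum wz //.
  under eq_bigr do rewrite wz ?w_feasible.1 //.
  by rewrite -mulr_suml ler_wpM2r ?ler0n // w_feasible.2.
- rewrite wz //.
  under [leRHS]eq_bigr do rewrite wz ?w_feasible.1 //.
  by rewrite -mulr_suml [leLHS]mulrA ler_wpM2r.
Qed.

(** * Padding a finite set to a given size *)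

Lemma fset_superset_of_card (K : choiceType) (g : nat -> K) (A : {fset K})
    (n : nat) : injective g -> (#|` A| <= n)%N ->
  exists2 B : {fset K}, (A `<=` B)%fset & #|` B| = n.
Proof.
move=> g_inj /subnK <-; elim: (n - _)%N => [|k [B AB cB]]; first by exists A.
(* One more value of [g] than [B] has elements, so some value is new. *)
pose G := [fset g (val i) | i in 'I_#|` B|.+1]%fset.
have cG : #|` G| = #|` B|.+1.
  by rewrite card_imfset /= -?cardE ?card_ord // => i j /g_inj/val_inj.
have /fsubsetPn[x _ xB] : ~~ (G `<=` B)%fset.
  by apply/negP => /fsubset_leq_card; rewrite cG ltnn.
exists (x |` B)%fset; first exact: fsubset_trans AB (fsubsetU1 _ _).
by rewrite cardfsU1 xB cB.
Qed.

(** * Motifs from colourings of the edges *)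

Section Colourings.
Variables (R : realType) (p L : nat) (M : motif_spec R p L).
Notation H := (motif_hypergraph M).
Variable n : edge H -> nat.
Notation colouring := {dffun forall e : edge H, 'I_(n e).+1}.

Definition colouring_point (c : colouring) (i : 'I_L) : 'rV[R]_p :=
  \row_m if [pick e : edge H | ((val e).1 == m) && (i \in incidence e)]
         is Some e then (c e)%:R else Defs.constant M i m.

(** Blocks of one partition are disjoint, so [pick] can find no edge but [e]. *)
Lemma colouring_point_edge (c : colouring) (e : edge H) (i : 'I_L) :
  i \in incidence e -> colouring_point c i ord0 (val e).1 = (c e)%:R.
Proof.
move=> ie; rewrite mxE; case: pickP => [e' /andP[/eqP ee' ie']|/(_ e)]; last first.
  by rewrite eqxx ie.
suff -> : e' = e by [].
apply/val_inj; case: e e' ie ee' ie' => [[m B] /= Bm] [[m' B'] /= B'm] /= iB mm' iB'.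
rewrite {m'}mm' in B'm *; congr pair.
have /and3P[_ triv _] := blocks_partition M m.
by rewrite -(def_pblock triv Bm iB) (def_pblock triv B'm iB').
Qed.

Lemma colouring_point_motif (c : colouring) : is_motif M (colouring_point c).
Proof.
split => [m B Bm i j iB jB|m i iB].
  pose e : edge H := exist _ (m, B) Bm.
  by rewrite (colouring_point_edge c e) ?(colouring_point_edge c e).
rewrite mxE; case: pickP => // [[[m' B] /= Bm] /andP[/eqP /= mm']].
by rewrite -mm' in iB; rewrite (negPf (iB _ Bm)).
Qed.

(** No edge is empty, so each colour can be read off at some position. *)
Lemma colouring_point_inj (c c' : colouring) :
  colouring_point c =1 colouring_point c' -> c = c'.
Proof.
move=> cc'; apply/ffunP => e.
have /set0Pn[i ie] := motif_hypergraph_edge_neq0 e.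
have := colouring_point_edge c e i ie.
rewrite cc' (colouring_point_edge c' e i ie) => /eqP.
by rewrite eqr_nat => /eqP h; apply/val_inj.
Qed.

(* The colours of the edges at [i] determine the point at [i], so all other
   edges may be recoloured with [0] before counting. *)
Definition local_colouring (i : 'I_L) : pred colouring :=
  family (fun e : edge H =>
    if i \in incidence e then predT else pred1 (ord0 : 'I_(n e).+1)).

Definition recolour (i : 'I_L) (c : colouring) : colouring :=
  [ffun e => if i \in incidence e then c e else ord0].

Lemma recolour_local (i : 'I_L) (c : colouring) :
  recolour i c \in local_colouring i.
Proof. by apply/familyP => e; rewrite ffunE; case: ifP; rewrite inE. Qed.

Lemma colouring_point_recolour (i : 'I_L) (c : colouring) :
  colouring_point (recolour i c) i = colouring_point c i.
Proof.
apply/rowP => m; rewrite !mxE; case: pickP => // e /andP[_ ie].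
by rewrite ffunE ie.
Qed.

Lemma card_local_colouring (i : 'I_L) :
  #|local_colouring i| = (\prod_(e | i \in incidence e) (n e).+1)%N.
Proof.
rewrite card_family foldrE big_image [RHS]big_mkcond /=; apply: eq_bigr => e _.
by case: ifP; rewrite ?card1 // cardT size_enum_ord.
Qed.

Lemma card_colouring : #|{: colouring}| = (\prod_e (n e).+1)%N.
Proof.
rewrite card_dep_ffun foldrE big_image.
by apply: eq_bigr => e _; rewrite card_ord.
Qed.

Definition colouring_points : {fset 'rV[R]_p} :=
  [fset colouring_point x.2 x.1
    | x : 'I_L * colouring in [pred x | x.2 \in local_colouring x.1]]%fset.

Lemma mem_colouring_points (c : colouring) (i : 'I_L) :
  colouring_point c i \in colouring_points.
Proof.
apply/imfsetP; exists (i, recolour i c); first exact: recolour_local.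
by rewrite /= colouring_point_recolour.
Qed.

Lemma card_colouring_points (b : nat) :
  (forall i : 'I_L, \prod_(e | i \in incidence e) (n e).+1 <= b)%N ->
  (#|` colouring_points| <= L * b)%N.
Proof.
move=> nb; apply: leq_trans (leq_imfset_card _ _ _) _; rewrite /= -cardE.
rewrite -sum1_card -(pair_big_dep predT local_colouring (fun _ _ => 1%N)) /=.
rewrite -[L in (L * _)%N]card_ord -sum_nat_const; apply: leq_sum => i _.
by rewrite sum1_card card_local_colouring.
Qed.

Lemma card_colouring_motifs (S : {fset 'rV[R]_p}) :
  (colouring_points `<=` S)%fset -> (\prod_e (n e).+1 <= motif_count M S)%N.
Proof.
move=> subS.
have memS c i := fsubsetP subS _ (mem_colouring_points c i).
pose t (c : colouring) : {ffun 'I_L -> S} := [ffun i => FSetSub (memS c i)].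
have t_inj : injective t.
  move=> c c' /ffunP tt'; apply: colouring_point_inj => i.
  by have /(congr1 val) := tt' i; rewrite !ffunE.
rewrite -card_colouring -(card_codom t_inj); apply: subset_leq_card.
apply/fintype.subsetP => _ /codomP[c ->]; rewrite inE; apply/asboolP.
rewrite (_ : (fun i => _) = colouring_point c); first exact: colouring_point_motif.
by apply/funext => i; rewrite ffunE.
Qed.

End Colourings.

(** * Choice of the number of colours and final count *)

Theorem theorem3 (R : realType) (p L : nat) (p_gt0 : (0 < p)%N)
    (L_gt0 : (0 < L)%N) (M : motif_spec R p L) (N : R) (N_gt0 : 0 < N) :
  exists S : {fset 'rV[R]_p},
    N <= (#|` S|)%:R /\
    ((#|` S|)%:R / L%:R) `^
        fractional_matching_number R (motif_hypergraph M)
      <= (motif_count M S)%:R.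
Proof.
have [D [a [D_gt0 aD nuD]]] :=
  integral_optimal_matching R _ _ (@motif_hypergraph_edge_neq0 R p L M).
(* This [q] exceeds both [N] and 1. The predecessor offsets the successor in the colour sets
   ['I_(n e).+1]. *)
pose q := (Num.truncn N).+2; pose n e := (q ^ a e).-1.
have nE e : (n e).+1 = (q ^ a e)%N by rewrite prednK // expn_gt0.
(* As [p] is positive, constant rows supply infinitely many points for padding. *)
have row_inj : injective (fun k : nat => const_mx k%:R : 'rV[R]_p).
  move=> k k' /rowP /(_ (Ordinal p_gt0)); rewrite !mxE => /eqP.
  by rewrite eqr_nat => /eqP.
have n_local i : (\prod_(e | i \in incidence e) (n e).+1 <= q ^ D)%N.
  by under eq_bigr do rewrite nE; rewrite -expn_sum leq_pexp2l.
have [S subS cardS] := fset_superset_of_card _ _ _ _ row_inj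
  (card_colouring_points R p L M n _ n_local).
exists S; rewrite cardS; split.
  apply: (@le_trans _ _ q%:R).
    by rewrite ltW // (lt_trans (truncnS_gt N)) // ltr_nat.
  rewrite ler_nat (leq_trans (leq_pmull q L_gt0)) // leq_mul //.
  by rewrite -{1}[q]expn1 leq_pexp2l.
rewrite natrM mulrC mulKf ?pnatr_eq0 -?lt0n //.
apply: le_trans (_ : (\prod_e (n e).+1)%:R <= _); last first.
  by rewrite ler_nat card_colouring_motifs.
under eq_bigr do rewrite nE.
(* Both sides become powers of [q], and [nuD] compares the exponents. *)
rewrite -expn_sum !natrX -!powR_mulrn ?ler0n // -powRrM mulrC.
by apply: ler_powR; rewrite ?ler1n // natr_sum.
Qed.
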